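(* Let $X$ be a connected topological space such that each nonempty open subset of $X$ contains a closed (in $X$) separable set of cardinality $\mathfrak{c}$. Let $Y$ be a separably connected $T_1$ space. Suppose that $X\times Y$ is a $T_5$ space of cardinality $\mathfrak{c}$ whose separable subsets are hereditarily separable. Then there exists a function $F\colon X\to Y$ whose graph is connected and dense in $X\times Y$.
   Context: $\mathfrak{c}$ denotes the cardinality of the continuum. A space is separably connected if any two of its points are contained in a connected separable subset. A space $Z$ is $T_1$ if all singletons are closed. A space $Z$ is $T_5$ if for any $A,B\subset Z$ with $\overline{A}\cap B=A\cap\overline{B}=\emptyset$ there are disjoint open sets $U_1,U_2\subset Z$ with $A\subset U_1$ and $B\subset U_2$ ($T_5$ is not assumed to include $T_1$). A set is hereditarily separable if each of its subsets is separable in the subspace topology. $X\times Y$ carries the product topology, and the graph of $F$ is $\{(x,F(x))\colon x\in X\}\subset X\times Y$; it is called connected if it is connected in the subspace topology. *)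

(* Defs.v *)
(* MathComp-Analysis *)
From HB Require Import structures.
From mathcomp Require Import all_boot all_order all_algebra.
From mathcomp Require Import boolp classical_sets functions cardinality.
From mathcomp Require Import reals topology.

Set Implicit Arguments.
Unset Strict Implicit.
Unset Printing Implicit Defensive.

Local Open Scope classical_set_scope.

(* The closure of D in the subspace A is A `&` closure D, so for D `<=` A the
   last clause says that D is dense in the subspace A. *)
Definition separable {T : topologicalType} (A : set T) : Prop :=
  exists D : set T, [/\ countable D, D `<=` A & A `<=` closure D].

Definition hereditarily_separable {T : topologicalType} (A : set T) : Prop :=
  forall B : set T, B `<=` A -> separable B.

Definition separably_connected (T : topologicalType) : Prop :=
  forall x y : T, exists C : set T, [/\ connected C, separable C, C x & C y].

Definition T1_space (T : topologicalType) : Prop :=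
  forall x : T, closed [set x].

(* [T1_space T] is not part of the definition. *)
Definition T5_space (T : topologicalType) : Prop :=
  forall A B : set T, separated A B ->
    exists U V : set T,
      [/\ open U, open V, U `&` V = set0, A `<=` U & B `<=` V].

Definition has_card_continuum (R : realType) {T : Type} (A : set T) : Prop :=
  (A #= [set: R])%card.

Definition graph_of {X Y : Type} (F : X -> Y) : set (X * Y) :=
  [set (x, F x) | x in [set: X]].

(* Main.v *)
Require Import Defs.
From HB Require Import structures.
From Stdlib Require Import Inverse_Image.
From mathcomp Require Import all_boot all_order all_algebra.
From mathcomp Require Import boolp classical_sets functions cardinality.
From mathcomp Require Import reals topology wochoice.
From mathcomp Require Import lra.

(** The graph is built so as to meet every closed set that is too large to be
    avoided, and then any set able to disconnect it is shown to be that large.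

    Call a separable subset of X * Y large when its projection to X has at least
    continuum many points.  The closures of countable subsets of X * Y are
    indexed by sequences in X * Y, so there are at most continuum many of them,
    since |R^N| <= |R| ([card_nat_seq_le]).  Those that are large therefore form
    a family, indexed by some I, whose projections all have at least |I| points.
    A transfinite recursion along a well order of I with small initial segments
    chooses pairwise distinct points in these projections
    ([injective_selector]).  Above the point chosen for an index, F takes a value
    that puts (x, F x) in the corresponding closure; distinctness makes the
    prescriptions compatible ([exists_graph_meeting_large_sets]).

    Density follows because a nonempty open set contains a closed separable
    large set of the form K * {y}.

    For connectedness, T5 turns a separation of the graph into a separation by
    disjoint open sets U and V of X * Y, and it is enough to find a large
    separable set S outside U and V: the graph meets the closed set ~ (U | V),
    which is absurd.  Since the graph lies in U | V, the open projections of U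
    and V cover X, so by connectedness of X some fiber {x} * Y meets both, say
    at y1 and y2.  Then all fibers over a neighbourhood W of x meet both U and V,
    at the same heights y1 and y2.  If C is connected and separable
    and contains y1 and y2, each {z} * C with z in W must leave U | V.  So for a
    separable K of size continuum inside W, the set S = (K * C) \ (U | V)
    projects onto K, and it is separable by hereditary separability
    ([large_set_between_opens]). *)

Import Order.TTheory GRing.Theory Num.Theory.
Local Open Scope classical_set_scope.

(** * Cardinality of the set of real sequences *)

Lemma card_leTP {T U : Type} {B : set U} :
  ([set: T] #<= B)%card <-> exists2 f : T -> U, injective f & forall t, B (f t).
Proof.
split=> [/card_leP[f]|[f f_inj fB]].
  exists (fun t => set_val (f (SigSub (in_setT t)))); last first.
    by move=> t; apply: set_valP.
  move=> t u /val_inj E.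
  have := @inj _ _ _ f (SigSub (in_setT t)) (SigSub (in_setT u)).
  by rewrite !inE => /(_ I I E) [].
have /injfunPex[g] :
    exists2 g : T -> U, set_fun [set: T] B g & set_inj [set: T] g.
  by exists f => // t u _ _; apply: f_inj.
exact: inj_card_le.
Qed.

Section real_sequences.
Local Open Scope ring_scope.

(** The Cantor map: a bit sequence b is sent to the sum of the b k / 3 ^ k, here
    the supremum of the partial sums.  In base 3 the terms after rank n add up to
    at most half of 1 / 3 ^ n, so the first differing bit is never compensated. *)
Lemma card_nat_bool_le (R : realType) :
  ([set: nat -> bool] #<= [set: R])%card.
Proof.
apply/card_leTP.
pose a (b : nat -> bool) n : R := \sum_(k < n) (b k)%:R * 3^-1 ^+ k.
have aS b n : a b n.+1 = a b n + (b n)%:R * 3^-1 ^+ n.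
  by rewrite /a big_ord_recr.
have e_gt0 n : 0 < (3^-1 : R) ^+ n by apply: exprn_gt0; lra.
have a_mono b m n : (m <= n)%N -> a b m <= a b n.
  elim: n => [|n IH]; first by rewrite leqn0 => /eqP ->.
  rewrite leq_eqVlt => /predU1P[->//|/IH]; rewrite aS.
  by have := e_gt0 n; case: (b n) => /=; lra.
(* The sum of 1 / 3 ^ k over k >= n is 3 / 2 * 1 / 3 ^ n: a partial sum plus this
   bound on its remainder decreases with the rank. *)
have a_tail b m n : (m <= n)%N ->
    a b n + 3 / 2 * 3^-1 ^+ n <= a b m + 3 / 2 * 3^-1 ^+ m.
  elim: n => [|n IH]; first by rewrite leqn0 => /eqP ->.
  rewrite leq_eqVlt => /predU1P[->//|/IH]; rewrite aS exprS.
  by have := e_gt0 n; case: (b n) => /=; lra.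
have a_ub b m n : a b n <= a b m + 3 / 2 * 3^-1 ^+ m.
  have := a_tail b _ _ (leq_maxl m n); have := a_mono b _ _ (leq_maxr m n).
  by have := e_gt0 (maxn m n); lra.
pose f b := sup (range (a b)).
have f_ge b n : a b n <= f b.
  apply: ub_le_sup; last by exists n.
  by exists (a b 0 + 3 / 2 * 3^-1 ^+ 0) => _ [m _ <-]; apply: a_ub.
have f_le b n : f b <= a b n + 3 / 2 * 3^-1 ^+ n.
  by apply: ge_sup => [|_ [m _ <-]]; [exists (a b 0), 0%N | apply: a_ub].
exists f => // b c fbc; apply/funext => n.
elim/ltn_ind: n => n IH.
have abc : a b n = a c n by apply: eq_bigr => k _; rewrite IH.
move: (f_ge b n.+1) (f_ge c n.+1) (f_le b n.+1) (f_le c n.+1).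
rewrite fbc !aS abc exprS; have := e_gt0 n.
by case: (b n); case: (c n) => //=; lra.
Qed.

(** A real sequence s is determined by the set of pairs (i, q), with q rational,
    such that q < s i, hence by a sequence of bits. *)
Lemma card_nat_seq_le (R : realType) : ([set: nat -> R] #<= [set: R])%card.
Proof.
apply: (card_le_trans _ (card_nat_bool_le R)); apply/card_leTP.
exists (fun s n => if (unpickle n : option (nat * rat)) is Some (i, q)
                   then ratr q < s i else false) => // s t E.
apply/funext => i.
have {}E q : (ratr q < s i) = (ratr q < t i).
  by move/(congr1 (@^~ (pickle (i, q)))): E; rewrite /= pickleK.
apply: contrapT => /eqP; rewrite neq_lt => /orP[] /rat_in_itvoo[q];
  rewrite in_itv /= => /andP[].
- by rewrite -E => /lt_trans h /h; rewrite ltxx.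
- by rewrite E => /lt_trans h /h; rewrite ltxx.
Qed.

End real_sequences.

(** * Transfinite choice of distinct points *)

(** This replaces the initial ordinal of cardinality |I|.  If some initial
    segment of a well order of I is as large as I, an injection of I into the
    first such segment pulls the order back to one whose initial segments are
    all small. *)
Lemma exists_small_well_order (I : Type) : exists lt : I -> I -> Prop,
  [/\ well_founded lt, forall i j, i <> j -> lt i j \/ lt j i
    & forall j, ~ ([set: I] #<= [set i | lt i j])%card].
Proof.
have [R Rwo] := well_ordering_principle {classic I}.
have R_anti : antisymmetric R.
  move=> i j; apply: (@wo_chain_antisymmetric {classic I} R predT) => //.
  by move=> A _; apply: Rwo.
pose lt i j := ~~ R j i.
have lt_wf : well_founded lt.
  move=> i; apply: contrapT => nAcc.
  have [|z [[/asboolP zP zmin] _]] := Rwo [pred x | `[< ~ Acc lt x >]].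
    by exists i; apply/asboolP.
  apply: zP; constructor => y yz; apply: contrapT => yP.
  by move/negP: yz; apply; apply: zmin; apply/asboolP.
have lt_total i j : i <> j -> lt i j \/ lt j i.
  move=> ij; apply: contrapT => /not_orP[/negP/negPn Rji /negP/negPn Rij].
  by apply: ij; apply: R_anti; rewrite Rij Rji.
have [small|/existsNP[j1 /contrapT large1]] :=
    pselect (forall j, ~ ([set: I] #<= [set i | lt i j])%card).
  by exists lt.
have [j0 [large0 small]] : exists j, ([set: I] #<= [set i | lt i j])%card /\
    forall i, lt i j -> ~ ([set: I] #<= [set k | lt k i])%card.
  apply: contrapT => nmin; move: large1.
  elim/(well_founded_ind lt_wf): j1 => j IH large.
  by apply: nmin; exists j; split=> // i /IH.
have [g g_inj g_lt] := card_leTP.1 large0.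
exists (fun i j => lt (g i) (g j)); split.
- exact: (wf_inverse_image _ _ _ g lt_wf).
- by move=> i j ij; apply: lt_total => /g_inj.
- move=> j large; have [h h_inj h_lt] := card_leTP.1 large.
  apply: (small (g j)); first exact: g_lt.
  by apply/card_leTP; exists (g \o h) => // a b /g_inj /h_inj.
Qed.

(** Points are chosen by recursion along a well order with small initial
    segments: at stage j the points already used are too few to exhaust P j. *)
Lemma injective_selector {I T : Type} (P : I -> set T) :
  (forall i, [set: I] #<= P i)%card ->
  exists2 f : I -> T, injective f & forall i, P i (f i).
Proof.
move=> P_large.
have [lt [lt_wf lt_total lt_small]] := exists_small_well_order I.
have next j (rec : forall i, lt i j -> T) :
    exists t, P j t /\ forall i lij, rec i lij <> t.
  apply: contrapT => stuck.
  have [h h_inj hP] := card_leTP.1 (P_large j).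
  have /choice[k kE] i : exists k, exists lkj : lt k j, rec k lkj = h i.
    apply: contrapT => nk; apply: stuck; exists (h i); split=> // k lkj E.
    by apply: nk; exists k, lkj.
  apply: (lt_small j); apply/card_leTP; exists k => [a b kab|i]; last first.
    by have [] := kE i.
  apply: h_inj; have [la <-] := kE a; have [lb <-] := kE b.
  by move: la; rewrite kab => la; rewrite (Prop_irrelevance la lb).
pose step j rec := sval (cid (next j rec)).
pose f := Fix lt_wf (fun=> T) step.
have fE j : f j = step j (fun i _ => f i).
  apply: Fix_eq => {}j r1 r2 r12; congr step.
  by apply: functional_extensionality_dep => i; apply/funext => ?.
have fP j : P j (f j) /\ forall i, lt i j -> f i <> f j.
  by rewrite [f j]fE /step; case: cid.
exists f => [i j fij|i]; last by have [] := fP i.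
apply: contrapT => /lt_total[] /(proj2 (fP _)); first by apply.
by apply; rewrite fij.
Qed.

(** * Connected sets and product spaces *)

Lemma connected_two_opens {T : topologicalType} (A U V : set T) :
  connected A -> open U -> open V -> A `<=` U `|` V ->
  A `&` U !=set0 -> A `&` V !=set0 -> A `&` (U `&` V) !=set0.
Proof.
move=> A_conn oU oV AUV AU [v [Av Vv]].
apply: contrapT => /set0P/negP/negPn/eqP AUV0.
have notboth x : A x -> U x -> ~ V x.
  by move=> Ax Ux Vx; rewrite -[False]/(set0 x) -AUV0.
have E : A `&` U = A `&` ~` V.
  apply/seteqP; split=> x [Ax].
    by move=> Ux; split=> //; apply: notboth.
  by move=> nVx; split=> //; have [] := AUV _ Ax.
have AUA : A `&` U = A.
  by apply: A_conn => //; [exists U | exists (~` V) => //; apply: open_closedC].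
by move: Av; rewrite -AUA => -[Av Uv]; apply: (notboth v).
Qed.

Section product.
Context {X Y : topologicalType}.
Implicit Types (A : set X) (B : set Y) (U : set (X * Y)).

Lemma open_sectionl U y : open U -> open [set x | U (x, y)].
Proof.
rewrite !openE => oU x /oU [[P Q] [Px Qy] PQU].
by apply: filterS Px => p Pp; apply: PQU; split=> //=; apply: nbhs_singleton.
Qed.

Lemma open_sectionr U x : open U -> open [set y | U (x, y)].
Proof.
rewrite !openE => oU y /oU [[P Q] [Px Qy] PQU].
by apply: filterS Qy => q Qq; apply: PQU; split=> //=; apply: nbhs_singleton.
Qed.

Lemma separableX A B : separable A -> separable B -> separable (A `*` B).
Proof.
move=> [D [cD DA AD]] [E [cE EB BE]]; exists (D `*` E); split.
- exact: countableX.
- by move=> p [/DA ? /EB].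
- move=> p [/AD Dp /BE Ep] N [[P Q] [/Dp[d [Dd Pd]] /Ep[e [Ee Qe]]] PQN].
  by exists (d, e); split=> //; apply: PQN.
Qed.

Lemma closedX A B : closed A -> closed B -> closed (A `*` B).
Proof.
move=> cA cB p pAB; split; [apply: cA => N pN|apply: cB => N pN].
- have [|q [[Aq _] Nq]] := pAB (fst @^-1` N); last by exists q.1.
  exact: cvg_fst pN.
- have [|q [[_ Bq] Nq]] := pAB (snd @^-1` N); last by exists q.2.
  exact: cvg_snd pN.
Qed.

End product.

(** * A graph that meets all large closed sets *)

(** Only the closures of countable sets need to be met, and these are indexed by
    sequences, so there are few enough of them for [injective_selector]. *)
Lemma exists_graph_meeting_large_sets (R : realType) {X Y : topologicalType}
    (y0 : Y) :
  ([set: X * Y] #<= [set: R])%card ->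
  exists F : X -> Y, forall S E : set (X * Y),
    separable S -> ([set: R] #<= fst @` S)%card -> S `<=` E -> closed E ->
    graph_of F `&` E !=set0.
Proof.
move=> /card_leTP[g g_inj _].
pose I := {s : nat -> X * Y | ([set: R] #<= fst @` closure (range s))%card}.
have [f f_inj fP] : exists2 f : I -> X, injective f &
    forall i : I, (fst @` closure (range (sval i))) (f i).
  apply: (injective_selector (fun i : I => fst @` closure (range (sval i)))) => i.
  apply: (card_le_trans _ (svalP i)).
  apply: (card_le_trans _ (card_nat_seq_le R)).
  apply/card_leTP; exists (fun i n => g (sval i n)) => // a b ab.
  case: a b ab => a a_large [b b_large] /= ab; apply: val_inj => /=.
  by apply/funext => n; apply: g_inj; move/(congr1 (@^~ n)): ab.
have /choice[F FP] x : exists y, forall i, f i = x ->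
    closure (range (sval i)) (x, y).
  have [[i fi]|ni] := pselect (exists i, f i = x); last first.
    by exists y0 => i fi; case: ni; exists i.
  have [[a y] ? /= ax] := fP i; exists y => j.
  by rewrite -fi => /f_inj ->; rewrite -ax.
exists F => S E [D [cD DS SD]] S_large SE cE.
have clDE : closure D `<=` E.
  by rewrite (closure_id E).1 //; apply: closureS => p /DS /SE.
have D_large : ([set: R] #<= fst @` closure D)%card.
  by apply: (card_le_trans S_large); apply/subset_card_le/image_subset.
have [D0|/surjfunPex[s Ds]] := pfcard_geP cD.
  (* The empty set is no range of a sequence, but it is not large either. *)
  have [h _ hD] := card_leTP.1 D_large.
  by have [p] := hD (GRing.zero R); rewrite D0 closure0.
rewrite Ds in D_large clDE.
pose i : I := exist _ s D_large.
by exists (f i, F (f i)); split; [exists (f i) | apply: clDE; apply: (FP _ i)].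
Qed.

(** * Disjoint open sets are separated by a large set *)

(** Connectedness of X yields one fiber that meets both open sets, hence a whole
    neighbourhood of such fibers; connectedness in Y gives a gap in each. *)
Lemma large_set_between_opens (R : realType) {X Y : topologicalType} :
  connected [set: X] ->
  (forall W : set X, open W -> W !=set0 ->
     exists K, [/\ K `<=` W, separable K & ([set: R] #<= K)%card]) ->
  separably_connected Y ->
  (forall A : set (X * Y), separable A -> hereditarily_separable A) ->
  forall U V : set (X * Y), open U -> open V -> U `&` V = set0 ->
    U !=set0 -> V !=set0 -> (forall x, exists y, (U `|` V) (x, y)) ->
  exists S : set (X * Y),
    [/\ separable S, ([set: R] #<= fst @` S)%card & S `<=` ~` (U `|` V)].
Proof.
move=> X_conn X_open Y_conn hersep U V oU oV UV0 [u Uu] [v Vv] fibers.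
have [x [_ [[[a y1] U1 /= ax] [[b y2] V2 /= bx]]]] :
    [set: X] `&` (fst @` U `&` fst @` V) !=set0.
  apply: connected_two_opens => //; try exact: fst_open.
  - by move=> x _; have [y [Uy|Vy]] := fibers x; [left|right]; exists (x, y).
  - by exists u.1; split=> //; exists u.
  - by exists v.1; split=> //; exists v.
move: U1 V2; rewrite {}ax {}bx => U1 V2 {a b}.
have [C [C_conn C_sep C1 C2]] := Y_conn y1 y2.
have [||K [KW K_sep K_large]] := X_open
    ([set z | U (z, y1)] `&` [set z | V (z, y2)]).
- by apply: openI; apply: open_sectionl.
- by exists x.
exists ((K `*` C) `&` ~` (U `|` V)); split=> [||p []//].
  by apply: hersep (separableX _ _ K_sep C_sep) _ _ => p [].
apply: (card_le_trans K_large); apply: subset_card_le => z Kz.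
have [Uz Vz] := KW _ Kz; apply: contrapT => nz.
have [|||||y [_ [Uy Vy]]] := @connected_two_opens Y C
    [set y | U (z, y)] [set y | V (z, y)] C_conn.
- exact: open_sectionr.
- exact: open_sectionr.
- by move=> y Cy; apply: contrapT => nUV; apply: nz; exists (z, y).
- by exists y1.
- by exists y2.
by rewrite -[False]/(set0 (z, y)) -UV0.
Qed.

(** * Density and connectedness of the graph *)

Theorem theorem4 (R : realType) (X Y : topologicalType)
  (X_connected : connected [set: X])
  (X_open : forall U : set X, open U -> U !=set0 ->
     exists K : set X,
       [/\ K `<=` U, closed K, separable K & has_card_continuum R K])
  (Y_sepconn : separably_connected Y)
  (Y_T1 : T1_space Y)
  (XY_T5 : T5_space (X * Y)%type)
  (XY_card : has_card_continuum R [set: X * Y])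
  (XY_hersep : forall A : set (X * Y),
     separable A -> hereditarily_separable A) :
  exists F : X -> Y, connected (graph_of F) /\ dense (graph_of F).
Proof.
move: XY_card; rewrite /has_card_continuum card_eq_le => /andP[XY_le XY_ge].
have [h _ _] := card_leTP.1 XY_ge.
have [F F_meets] :=
  exists_graph_meeting_large_sets R (h (GRing.zero R)).2 XY_le.
have X_open_ge (W : set X) : open W -> W !=set0 ->
    exists K, [/\ K `<=` W, closed K, separable K & ([set: R] #<= K)%card].
  move=> oW W0; have [K [KW cK sK KR]] := X_open W oW W0.
  exists K; split=> //.
  by move: KR; rewrite /has_card_continuum card_eq_le => /andP[].
exists F; split.
  apply/connectedP => E [E0 gE /XY_T5[U [V [oU oV UV0 EU EV]]]].
  have gUV p : graph_of F p -> (U `|` V) p.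
    by rewrite gE => -[/EU|/EV]; [left|right].
  have [|||x|S [S_sep S_large SUV]] := large_set_between_opens R X_connected _
      Y_sepconn XY_hersep U V oU oV UV0.
  - by move=> W oW W0; have [K [KW _ ? ?]] := X_open_ge W oW W0; exists K.
  - by have [p /EU] := E0 false; exists p.
  - by have [p /EV] := E0 true; exists p.
  - by exists (F x); apply: gUV; exists x.
  have [|p [/gUV]] := F_meets _ _ S_sep S_large SUV; last by [].
  by apply: open_closedC; apply: openU.
move=> O [[x y] Oxy] oO.
have [||K [KO cK K_sep K_large]] := X_open_ge [set z | O (z, y)].
- exact: open_sectionl.
- by exists x.
rewrite setIC.
have [||||p [gp [/KO Op /= py]]] := F_meets (K `*` [set y]) (K `*` [set y]).
- by apply: separableX => //; exists [set y]; split=> //; apply: subset_closure.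
- apply: (card_le_trans K_large).
  by apply: subset_card_le => z Kz; exists (z, y).
- by [].
- exact: closedX.
by exists p; split=> //; rewrite [p]surjective_pairing py.
Qed.
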